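(* (1) Let $\mu$ be a positive Borel measure on $\mathbf{C}$ with $\mu(\mathbf{C})\le 1$ that is symmetric with respect to complex conjugation, and suppose that the potential $$u(z)=\int_{|\zeta|\le 1}\log|z-\zeta|\,d\mu(\zeta)+\int_{|\zeta|>1}\log\left|1-\frac{z}{\zeta}\right|d\mu(\zeta)$$ satisfies $u(z)\le u(|z|)$ for all $z\in\mathbf{C}$. Then $$\mu(\{z\in\mathbf{C}\setminus\{0\}: |\arg z|\le\alpha\})\le\frac{2\alpha}{\pi}\,\mu(\mathbf{C}\setminus\{0\})\quad\text{for all } 0\le\alpha\le\pi/2.$$ (2) In particular, if $f$ is a non-constant polynomial satisfying $|f(z)|\le f(|z|)$ for all $z\in\mathbf{C}$, then the empirical measure $\mu=\mu[f]$ satisfies $$\mu(\{z\in\mathbf{C}\setminus\{0\}: |\arg z|\le\alpha\})\le\frac{2\alpha}{\pi}\,\mu(\mathbf{C}\setminus\{0\})\quad\text{for all } 0\le\alpha\le\pi/2.$$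
   Context: For a non-constant polynomial $P$, the empirical measure $\mu[P]$ is the discrete probability measure on $\mathbf{C}$ which has an atom of mass $m/\deg P$ at every zero of $P$ of multiplicity $m$. Symmetry of $\mu$ with respect to complex conjugation means $\mu(\{\overline{z}:z\in E\})=\mu(E)$ for every Borel set $E\subset\mathbf{C}$. Here $\arg z\in(-\pi,\pi]$ is the principal argument. The inequality $|f(z)|\le f(|z|)$ includes the requirement that $f(r)$ is real and non-negative for $r\ge 0$. The potential $u$ is a well-defined subharmonic function $\mathbf{C}\to[-\infty,\infty)$ with $u\not\equiv-\infty$ for every positive measure $\mu$ with $\mu(\mathbf{C})<\infty$. *)

(* Defs.v *)
From HB Require Import structures.
From mathcomp Require Import all_boot all_order all_algebra.
From mathcomp Require Import all_classical all_reals all_analysis.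
From mathcomp Require Export complex.

Set Implicit Arguments.
Unset Strict Implicit.
Unset Printing Implicit Defensive.

Import Order.TTheory GRing.Theory Num.Theory.
Import numFieldNormedType.Exports.

Local Open Scope classical_set_scope.
Local Open Scope complex_scope.
Local Open Scope ring_scope.

(* The library puts the topology of the modulus on R[i]^o, an alias of R[i];
   this is the complex plane with the Borel sigma-algebra of that topology. *)
Definition borelC (R : realType) :=
  g_sigma_algebraType (@open (R[i]^o : topologicalType)).

HB.instance Definition _ (R : realType) := Measurable.on (borelC R).

(* Real-valued modulus; the norm `|z| of the library lives in R[i]. *)
Definition cmod (R : realType) (z : R[i]) : R := Normc.normc z.

Definition Arg_spec (R : realType) (z : R[i]) : set R :=
  [set t | - pi < t <= pi /\ z = (cmod z)%:C * (cos t +i* sin t)].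

(* The principal argument; its value at 0 is irrelevant. *)
Definition Arg (R : realType) (z : R[i]) : R := xget 0 (Arg_spec z).

Lemma cmodE (R : realType) (z : R[i]) : `|z| = (cmod z)%:C.
Proof. by case: z. Qed.

Lemma Arg_spec_exists (R : realType) (z : R[i]) : z != 0 -> Arg_spec z !=set0.
Proof.
case: z => a b z0; set r := cmod (a +i* b).
have r2 : r ^+ 2 = a ^+ 2 + b ^+ 2 by rewrite /r/= sqr_sqrtr// addr_ge0 ?sqr_ge0.
have r0 : 0 < r.
  rewrite lt_neqAle sqrtr_ge0 andbT eq_sym; apply: contra z0 => /eqP r0.
  by apply/eqP; apply: Normc.eq0_normc.
have rn0 : r != 0 by rewrite gt_eqF.
have ar : `|a / r| <= 1.
  rewrite normrM normfV (gtr0_norm r0) ler_pdivrMr// mul1r.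
  by rewrite -(gtr0_norm r0) -ler_sqr ?nnegrE// !real_normK ?num_real// r2 lerDl sqr_ge0.
have {}ar : -1 <= a / r <= 1 by rewrite -ler_norml.
have cK : cos (acos (a / r)) = a / r by rewrite acosK.
have sK : sin (acos (a / r)) = `|b| / r.
  rewrite sin_acos// -[RHS]ger0_norm ?divr_ge0 ?(ltW r0)// -sqrtr_sqr.
  congr Num.sqrt; rewrite !exprMn !exprVn real_normK ?num_real//.
  have : r ^+ 2 != 0 by rewrite expf_neq0.
  move=> r20; apply: (mulIf r20); rewrite mulrBl mul1r !divfK//.
  by rewrite r2 addrAC subrr add0r.
have zE (t : R) : a = r * cos t -> b = r * sin t ->
    a +i* b = r%:C * (cos t +i* sin t).
  by move=> ha hb; rewrite [RHS]/GRing.mul/= !mul0r subr0 addr0 -ha -hb.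
have [b0|b0] := leP 0 b.
- exists (acos (a / r)); split.
    by rewrite acos_lepi// andbT (lt_le_trans _ (acos_ge0 ar))// oppr_lt0 pi_gt0.
  by apply: zE; rewrite ?cK ?sK ?(ger0_norm b0) [RHS]mulrC divfK.
- exists (- acos (a / r)); split.
    rewrite ltrN2; apply/andP; split; last first.
      by rewrite (le_trans _ (pi_ge0 _))// oppr_le0 acos_ge0.
    rewrite acos_ltpi//; case/andP: ar => ar1 ->; rewrite andbT lt_neqAle ar1 andbT.
    apply: contraTneq b0 => arN; rewrite -leNgt.
    have : sin (acos (a / r)) = 0 by rewrite -arN acosN1 sinpi.
    rewrite sK => /eqP; rewrite mulf_eq0 invr_eq0 (negbTE rn0) orbF normr_eq0.
    by move=> /eqP ->.
  apply: zE; first by rewrite cosN cK [RHS]mulrC divfK.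
  by rewrite sinN sK (ltr0_norm b0) mulNr opprK [RHS]mulrC divfK.
Qed.

Lemma ArgP (R : realType) (z : R[i]) : z != 0 ->
  - pi < Arg z <= pi /\ z = (cmod z)%:C * (cos (Arg z) +i* sin (Arg z)).
Proof. by move=> /Arg_spec_exists[t zt]; exact: (xgetI 0 zt). Qed.

(* lne 0 = -oo, and the integral is that of the positive part minus that of the
   negative part. For finite mu both positive parts have finite integrals, so
   neither the integrals nor their sum meet +oo - +oo. *)
Definition log_potential (R : realType)
    (mu : {measure set (borelC R) -> \bar R}) (z : R[i]) : \bar R :=
  (\int[mu]_(w in [set w : borelC R | (cmod w <= 1)%R])
      lne (cmod (z - (w : R[i])))%:E +
   \int[mu]_(w in [set w : borelC R | (1 < cmod w)%R])
      lne (cmod (1 - z / (w : R[i])))%:E)%E.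

Definition conj_symmetric (R : realType)
    (mu : {measure set (borelC R) -> \bar R}) : Prop :=
  forall E : set (borelC R), measurable E ->
    mu ((@conjc R : borelC R -> borelC R) @` E) = mu E.

Definition sector (R : realType) (alpha : R) : set (borelC R) :=
  [set z : R[i] | z != 0 /\ `|Arg z| <= alpha].

(* The degree of P is (size P).-1. *)
Definition empirical_measure (R : realType) (P : {poly R[i]})
    (E : set (borelC R)) : \bar R :=
  (\sum_(w \in [set w : R[i] | root P w])
     ((mup w P)%:R / (size P).-1%:R : R)%:E * @dirac _ (borelC R) w R E)%E.

Lemma finite_roots (R : realType) (P : {poly R[i]}) :
  P != 0 -> finite_set [set w : R[i] | root P w].
Proof.
move=> P0; have [s Ps] := closed_field_poly_normal P.
apply: (sub_finite_set _ (finite_seq s)) => w /=.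
by rewrite {1}Ps rootZ ?lead_coef_eq0// root_prod_XsubC.
Qed.

Section empirical_measure_measure.
Variables (R : realType) (P : {poly R[i]}).

Let c (w : R[i]) : R := (mup w P)%:R / (size P).-1%:R.

Let c_ge0 w : 0 <= c w. Proof. by rewrite divr_ge0. Qed.

Let m (s : seq R[i]) : {measure set (borelC R) -> \bar R} :=
  msum (fun k => mscale (NngNum (c_ge0 (nth 0 s k))) (@dirac _ (borelC R) (nth 0 s k) R))
    (size s).

Let mE s E : m s E =
  (\sum_(w <- s) (c w)%:E * @dirac _ (borelC R) w R E)%E.
Proof. by rewrite (big_nth 0) big_mkord. Qed.

Let empirical_measureE : exists s, empirical_measure P = m s.
Proof.
have [P0|P0] := eqVneq P 0.
  exists [::]; apply/funext => E; rewrite mE big_nil /empirical_measure.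
  by apply: fsbig1 => w _; rewrite P0 size_poly0 invr0 mulr0 mul0e.
exists (finmap.enum_fset (fset_set [set w : R[i] | root P w])); apply/funext => E.
by rewrite mE /empirical_measure fsbig_finite//; exact: finite_roots.
Qed.

Let emp0 : empirical_measure P set0 = 0%E.
Proof. by have [s ->] := empirical_measureE; exact: measure0. Qed.

Let emp_ge0 E : (0 <= empirical_measure P E)%E.
Proof. by have [s ->] := empirical_measureE; exact: measure_ge0. Qed.

Let emp_sigma_additive : semi_sigma_additive (empirical_measure P).
Proof. by have [s ->] := empirical_measureE; exact: measure_semi_sigma_additive. Qed.

HB.instance Definition _ := isMeasure.Build _ _ _ (empirical_measure P)
  emp0 emp_ge0 emp_sigma_additive.

End empirical_measure_measure.

(* Main.v *)
Require Import Defs.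
From HB Require Import structures.
From mathcomp Require Import all_boot all_order all_algebra ring lra.
From mathcomp Require Import all_classical all_reals all_analysis.
From mathcomp Require Import measurable_realfun.

Set Implicit Arguments.
Unset Strict Implicit.
Unset Printing Implicit Defensive.

Import Order.TTheory GRing.Theory Num.Theory.
Import numFieldNormedType.Exports.

Local Open Scope classical_set_scope.
Local Open Scope complex_scope.
Local Open Scope ring_scope.

(** Put [N(z,w) = ln (|z| + |w|) - ln |z - w| >= 0]. The potential [u(z)] is a
    finite function of [|z|] minus the integral of [N(z,.)], so [u(z) <= u(|z|)]
    says that the integral of [N(r,.)] is at most that of [N(r e^(it),.)] for all
    [r > 0] and [t]. Integrate this against [dr/r] and exchange the integrals: the
    integral of [N(r e^(it),w) dr/r] over the half-line is [(pi - x)^2 / 2], where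
    [x] is the angle between [e^(it)] and [w]. Take [t = 2 alpha] and
    [t = - 2 alpha] and add: with [phi = |Arg w|] this gives
      [2 pi \int max(2 alpha - phi, 0) dmu <= 4 alpha^2 mu(C \ 0)],
    whose left-hand side is at least [2 pi alpha] times the mass of the sector.
    Case [alpha = 0] is a limit. *)

(** * The half-line integral of the logarithmic kernel *)

Section fubini_tonelli_on.
Local Open Scope ereal_scope.
Context d1 d2 (T1 : measurableType d1) (T2 : measurableType d2) (R : realType).
Variables (m1 : {sigma_finite_measure set T1 -> \bar R})
          (m2 : {sigma_finite_measure set T2 -> \bar R}).
Variables (A : set T1) (B : set T2) (f : (T1 * T2)%type -> \bar R).
Hypotheses (mA : measurable A) (mB : measurable B).
Hypothesis mf : measurable_fun (A `*` B) f.
Hypothesis f0 : forall x, (A `*` B) x -> 0 <= f x.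

(** Extension by zero off the rectangle: the lemmas below then follow from Tonelli's theorem on the
    whole product, because the sections of [g] over [A] and [B] integrate to the restricted
    integrals of [f]. *)
Let g := f \_ (A `*` B).

Let mg : measurable_fun setT g.
Proof. by apply/(measurable_restrictT _ (measurableX mA mB)). Qed.

Let g0 x : 0 <= g x.
Proof. by rewrite /g patchE; case: ifPn => // /set_mem/f0. Qed.

Let gA x : A x -> \int[m2]_(y in B) f (x, y) = \int[m2]_y g (x, y).
Proof.
move=> Ax; rewrite [LHS]integral_mkcond; apply: eq_integral => y _.
by rewrite /g !patchE in_setX (mem_set Ax).
Qed.

Let gB y : B y -> \int[m1]_(x in A) f (x, y) = \int[m1]_x g (x, y).
Proof.
move=> By; rewrite [LHS]integral_mkcond; apply: eq_integral => x _.
by rewrite /g !patchE in_setX (mem_set By) andbT.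
Qed.

Lemma measurable_fun_integral_on :
  measurable_fun A (fun x => \int[m2]_(y in B) f (x, y)).
Proof.
apply: (@eq_measurable_fun _ _ _ _ A (fubini_F m2 g)).
  by move=> x /set_mem Ax; rewrite gA.
exact/measurable_funTS/measurable_fun_fubini_tonelli_F.
Qed.

Lemma measurable_fun_integral_on_swap :
  measurable_fun B (fun y => \int[m1]_(x in A) f (x, y)).
Proof.
apply: (@eq_measurable_fun _ _ _ _ B (fubini_G m1 g)).
  by move=> y /set_mem By; rewrite gB.
exact/measurable_funTS/measurable_fun_fubini_tonelli_G.
Qed.

Lemma fubini_tonelli_on :
  \int[m1]_(x in A) \int[m2]_(y in B) f (x, y) =
  \int[m2]_(y in B) \int[m1]_(x in A) f (x, y).
Proof.
transitivity (\int[m1]_x \int[m2]_y g (x, y)).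
  rewrite integral_mkcond; apply: eq_integral => x _; rewrite patchE.
  case: ifPn => [/set_mem/gA//|xA].
  by rewrite integral0_eq// => y _; rewrite /g patchE in_setX (negbTE xA).
rewrite (@fubini_tonelli _ _ _ _ _ m1 m2 g mg g0) [RHS]integral_mkcond; apply: eq_integral => y _.
rewrite patchE; case: ifPn => [/set_mem/gB//|yB].
by rewrite integral0_eq// => x _; rewrite /g patchE in_setX (negbTE yB) andbF.
Qed.

End fubini_tonelli_on.

(** * Law of cosines, Poisson kernel and the two ways of integrating it *)

Section law_of_cosines.
Context {R : realType}.
Implicit Types r s x : R.

(** Squared distance between points of moduli [r] and [s] seen from the origin under the angle
    [x]. *)
Definition dist2 r s x : R := r ^+ 2 - 2 * r * s * cos x + s ^+ 2.

Lemma dist2E r s x : dist2 r s x = (r - s * cos x) ^+ 2 + (s * sin x) ^+ 2.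
Proof. by rewrite sqrrB !exprMn sin2cos2 /dist2; ring. Qed.

Lemma dist2_gt0 r s x : 0 < s -> 0 < x < pi -> 0 < dist2 r s x.
Proof.
move=> s0 x0; rewrite dist2E ltr_wpDl ?sqr_ge0// exprn_gt0// mulr_gt0//.
exact: sin_gt0_pi.
Qed.

Lemma dist2_gt0_neq r s x : 0 < r -> 0 < s -> r != s -> 0 < dist2 r s x.
Proof.
move=> r0 s0 rs.
rewrite (_ : dist2 _ _ _ = (r - s) ^+ 2 + 2 * r * s * (1 - cos x)); last first.
  by rewrite /dist2; ring.
rewrite ltr_pwDl ?exprn_even_gt0 ?subr_eq0//.
by rewrite !mulr_ge0 ?(ltW r0) ?(ltW s0)// subr_ge0 cos_le1.
Qed.

(** Up to the factor [1 / pi], the Poisson kernel of the upper half-plane with pole [s e^(ix)], at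
    the real point [r]. It is also the [x]-derivative of [ln (dist2 r s x) / (2 r)], and this double
    nature links the logarithmic kernel to the angle. *)
Definition poisson r s x : R := s * sin x / dist2 r s x.

Lemma poisson_ge0 r s x : 0 < s -> 0 <= x <= pi -> 0 <= poisson r s x.
Proof.
move=> s0 x0; rewrite divr_ge0//.
  by rewrite mulr_ge0 ?(ltW s0)// sin_ge0_pi.
by rewrite dist2E addr_ge0// sqr_ge0.
Qed.

Lemma continuous_dist2_l s x : continuous (fun r => dist2 r s x).
Proof.
move=> r; rewrite /dist2; apply: cvgD; last exact: cvg_cst.
apply: cvgB; first exact: exprn_continuous.
apply: cvgM; last exact: cvg_cst.
apply: cvgM; last exact: cvg_cst.
by apply: cvgM => //; exact: cvg_cst.
Qed.

Lemma continuous_dist2_r r s : continuous (fun x => dist2 r s x).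
Proof.
move=> x; rewrite /dist2; apply: cvgD; last exact: cvg_cst.
apply: cvgB; first exact: cvg_cst.
apply: cvgM; first exact: cvg_cst.
exact: continuous_cos.
Qed.

Lemma continuous_poisson_l r s x :
  dist2 r s x != 0 -> {for r, continuous (fun r => poisson r s x)}.
Proof.
move=> d0; rewrite /poisson; apply: continuousM; first exact: cst_continuous.
by apply: continuousV => //; exact: continuous_dist2_l.
Qed.

Lemma continuous_poisson_r r s x :
  dist2 r s x != 0 -> {for x, continuous (fun x => poisson r s x)}.
Proof.
move=> d0; rewrite /poisson; apply: continuousM; last first.
  by apply: continuousV => //; exact: continuous_dist2_r.
apply: continuousM; first exact: cst_continuous.
exact: continuous_sin.
Qed.

(** As a function of [r] the kernel is a Lorentzian centred at [s cos x] of width [s sin x], so an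
    arctangent is a primitive. The value is [pi] times the harmonic measure of the positive
    half-line seen from [s e^(ix)]. *)
Lemma integral_poisson_radial s x : 0 < s -> 0 < x < pi ->
  (\int[lebesgue_measure]_(r in `[0%R, +oo[) (poisson r s x)%:E = (pi - x)%:E)%E.
Proof.
move=> s0 x0; have sx0 : 0 < sin x by exact: sin_gt0_pi.
have k0 : 0 < s * sin x by rewrite mulr_gt0.
pose F r := atan ((r - s * cos x) / (s * sin x)).
have dF r : is_derive r 1 F (poisson r s x).
  apply: is_derive_eq.
  rewrite /poisson dist2E /GRing.scale/=.
  rewrite mulr0 add0r subr0 mulr1; move: (r - _) k0 => a k0.
  field; rewrite !gt_eqF//= ?ltr_wpDl ?sqr_ge0 ?exprn_gt0//.
have cF r : {for r, continuous F}.
  apply: differentiable_continuous; apply/derivable1_diffP; exact: ex_derive.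
have Foo : F r @[r --> +oo] --> pi / 2.
  suff h : (r - s * cos x) / (s * sin x) @[r --> +oo] --> +oo.
    exact: cvg_comp h (@cvgy_atan R).
  apply: gt0_cvgMly; first by rewrite invr_gt0.
  apply/cvgryPge => A; near=> r; rewrite lerBrDr; near: r.
  exact: nbhs_pinfty_ge (num_real _).
rewrite (@ge0_continuous_FTC2y _ _ F 0 (pi / 2)).
- rewrite -EFinB; congr EFin; rewrite /F sub0r.
  (* The lower endpoint gives minus a cotangent; written as a tangent of an angle in []-pi/2,
     pi/2[], it is inverted by [atan]. *)
  have -> : - (s * cos x) / (s * sin x) = - tan (pi / 2 - x).
    rewrite /tan sinB cosB sin_pihalf cos_pihalf; field; lra.
  rewrite atanN tanK; first by lra.
  rewrite in_itv/=; apply/andP; split; lra.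
- by move=> r r0; rewrite poisson_ge0//; case/andP: x0 => /ltW -> /ltW ->.
- apply: continuous_in_subspaceT => r _.
  by apply: continuous_poisson_l; rewrite gt_eqF// dist2_gt0.
- exact: Foo.
- by move=> r _; exact: ex_derive.
- apply: cvg_at_right_filter; exact: cF.
- by move=> r _; rewrite derive1E; apply: derive_val.
Unshelve. all: end_near. Qed.

(* The half-line integral of [log_ratio r s x / r] is computed by writing it as
   an integral of [poisson r s] over [[x, pi]] and exchanging the integrals. *)
Definition log_ratio r s x : R := ln (r + s) - ln (dist2 r s x) / 2.

Lemma dist2_pi r s : dist2 r s pi = (r + s) ^+ 2.
Proof. by rewrite /dist2 cospi; ring. Qed.

(** The primitive [ln (dist2 r s y) / (2 r)] takes the value [ln (r + s) / r] at [y = pi]. The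
    condition [r != s] keeps [dist2] positive down to the angle zero. *)
Lemma integral_poisson_angular r s x : 0 < r -> 0 < s -> r != s ->
  0 <= x <= pi ->
  (\int[lebesgue_measure]_(y in `[x, pi]) (poisson r s y)%:E =
   (log_ratio r s x / r)%:E)%E.
Proof.
move=> r0 s0 rs /andP[x0]; rewrite le_eqVlt => /predU1P[->|xpi].
  rewrite set_itv1 integral_set1 /log_ratio dist2_pi lnXn ?addr_gt0//.
  by rewrite (_ : _ / r = 0)//; field; rewrite gt_eqF.
pose F y := ln (dist2 r s y) / 2 / r.
have dF (y : R) : is_derive y 1 F (poisson r s y).
  have d0 := dist2_gt0_neq y r0 s0 rs.
  rewrite /F.
  have dd : is_derive y 1 (dist2 r s) (2 * r * s * sin y).
    by apply: is_derive_eq; rewrite /GRing.scale/=; ring.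
  have ? := is_derive1_ln d0.
  apply: is_derive_eq.
  by rewrite /GRing.scale/= /poisson; field; rewrite !gt_eqF.
have cF (y : R) : {for y, continuous F}.
  apply: differentiable_continuous; apply/derivable1_diffP; exact: ex_derive.
rewrite (@continuous_FTC2 _ _ F)//.
- rewrite -EFinB; congr EFin; rewrite /F /log_ratio dist2_pi lnXn ?addr_gt0//.
  by field; rewrite gt_eqF.
- apply: continuous_in_subspaceT => y _.
  by apply: continuous_poisson_r; rewrite gt_eqF// dist2_gt0_neq.
- split.
  + by move=> y _; exact: ex_derive.
  + by apply: cvg_at_right_filter; exact: cF.
  + by apply: cvg_at_left_filter; exact: cF.
- by move=> y _; rewrite derive1E; apply: derive_val.
Qed.

Lemma integral_pi_sub x : 0 <= x <= pi ->
  (\int[lebesgue_measure]_(y in `[x, pi]) (pi - y)%:E =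
   ((pi - x) ^+ 2 / 2)%:E)%E.
Proof.
move=> /andP[x0]; rewrite le_eqVlt => /predU1P[->|xpi].
  by rewrite set_itv1 integral_set1 subrr expr0n/= mul0r.
have cpi (y : R) : {for y, continuous (fun y : R => pi - y)}.
  by apply: continuousB; [exact: cst_continuous|exact: cvg_id].
pose F (y : R) := - ((pi - y) ^+ 2 / 2).
have dF (y : R) : is_derive y 1 F (pi - y).
  rewrite /F.
  apply: is_derive_eq.
  by rewrite /GRing.scale/=; field.
have cF (y : R) : {for y, continuous F}.
  apply: differentiable_continuous; apply/derivable1_diffP; exact: ex_derive.
rewrite (@continuous_FTC2 _ _ F)//.
- by rewrite -EFinB; congr EFin; rewrite /F; field.
- apply: continuous_in_subspaceT => y _; exact: cpi.
- split.
  + by move=> y _; exact: ex_derive.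
  + by apply: cvg_at_right_filter; exact: cF.
  + by apply: cvg_at_left_filter; exact: cF.
- by move=> y _; rewrite derive1E; apply: derive_val.
Qed.

(** Inversion is discontinuous at 0, so it is glued from power functions on the two half-lines; at 0
    both conventions give 0. *)
Lemma measurable_invr : measurable_fun [set: R] (@GRing.inv R).
Proof.
pose f (x : R) := if 0 <= x then x `^ (-1) else - ((- x) `^ (-1)).
have -> : @GRing.inv R = f.
  apply/funext => x; rewrite /f; case: leP => x0.
    by rewrite powR_inv1.
  by rewrite powR_inv1 ?oppr_ge0 ?(ltW x0)// invrN opprK.
apply: measurable_fun_ifT; first exact: measurable_fun_ler.
  exact: measurable_powR.
apply: measurable_funN; apply: (measurableT_comp (measurable_powR _)).
exact: measurable_funN.
Qed.

Lemma measurable_dist2 d (T : measurableType d) (f g h : T -> R) D :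
  measurable_fun D f -> measurable_fun D g -> measurable_fun D h ->
  measurable_fun D (fun p => dist2 (f p) (g p) (h p)).
Proof.
move=> mf mg mh; apply: measurable_funD; last exact: measurable_funX.
apply: measurable_funB; first exact: measurable_funX.
apply: measurable_funM; last first.
  exact: (measurableT_comp (continuous_measurable_fun (@continuous_cos R)) mh).
apply: measurable_funM => //.
by apply: measurable_funM => //; exact: measurable_cst.
Qed.

Lemma measurable_log_ratio s x (D : set R) :
  measurable_fun D (fun r => (log_ratio r s x / r)%:E).
Proof.
apply/measurable_EFinP; apply: measurable_funTS; apply: measurable_funM; last first.
  exact: measurable_invr.
apply: measurable_funB.
  apply: (measurableT_comp (@measurable_ln R)).
  by apply: measurable_funD => //; exact: measurable_cst.
apply: measurable_funM; last exact: measurable_cst.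
apply: (measurableT_comp (@measurable_ln R)).
by apply: measurable_dist2 => //; exact: measurable_cst.
Qed.

Lemma integral_log_ratio s x : 0 < s -> 0 <= x <= pi ->
  (\int[lebesgue_measure]_(r in `]0%R, +oo[) (log_ratio r s x / r)%:E =
   ((pi - x) ^+ 2 / 2)%:E)%E.
Proof.
move=> s0 /andP[x0 xpi].
pose f (p : R * R) := (poisson p.1 s p.2)%:E.
have mf D : measurable_fun D f.
  apply/measurable_EFinP; apply: measurable_funTS; apply: measurable_funM.
    apply: measurable_funM; first exact: measurable_cst.
    apply: (measurableT_comp (continuous_measurable_fun (@continuous_sin R))).
    exact: measurable_snd.
  apply: (measurableT_comp measurable_invr).
  by apply: measurable_dist2; [exact: measurable_fst|exact: measurable_cst|exact: measurable_snd].
have f0 p : (`]0%R, +oo[ `*` `[x, pi]) p -> (0 <= f p)%E.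
  case: p => r y [/= r0]; rewrite in_itv/= => /andP[xy ypi].
  by rewrite lee_fin poisson_ge0// ypi (le_trans x0).
transitivity (\int[lebesgue_measure]_(r in `]0%R, +oo[)
    \int[lebesgue_measure]_(y in `[x, pi]) f (r, y))%E.
  (* The angular formula may fail at [r = s], a null set that is removed from both integrals. *)
  have mD : measurable (`]0%R, +oo[ `\ s) by exact: measurableD.
  have Df r : (`]0%R, +oo[ `\ s) r -> (log_ratio r s x / r)%:E =
      (\int[lebesgue_measure]_(y in `[x, pi]) f (r, y))%E.
    move=> [/= r0 rs]; rewrite integral_poisson_angular ?x0//.
      by move: r0; rewrite in_itv/= andbT.
    exact/eqP.
  rewrite -[LHS](@integral_setD1 _ _ s)//; last exact: measurable_log_ratio.
  rewrite -[RHS](@integral_setD1 _ _ s)//.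
    by apply: eq_integral => r /set_mem; exact: Df.
  have mlog := @measurable_log_ratio s x (`]0%R, +oo[ `\ s).
  by apply: eq_measurable_fun mlog => r /set_mem; exact: Df.
rewrite fubini_tonelli_on//; last exact: mf.
(* The radial formula requires a positive sine, so the endpoints of [[x, pi]] are dropped before it
   is applied and restored afterwards. *)
have Df y : `]x, pi[%classic y ->
    (\int[lebesgue_measure]_(r in `]0%R, +oo[) f (r, y) = (pi - y)%:E)%E.
  rewrite /= in_itv/= => /andP[xy ypi].
  rewrite integral_itv_obnd_cbnd//.
    by rewrite integral_poisson_radial// ypi andbT (le_lt_trans x0).
  apply: (measurableT_comp (mf setT)); exact/measurable_funTS/pair2_measurable.
have mpi : measurable_fun `]x, pi[ (fun y : R => (pi - y)%:E).
  apply/measurable_EFinP; apply: measurable_funB => //; exact: measurable_cst.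
have mF : measurable_fun `]x, pi[
    (fun y => \int[lebesgue_measure]_(r in `]0%R, +oo[) f (r, y))%E.
  by apply: eq_measurable_fun mpi => y /set_mem/Df.
rewrite (integral_itv_bndoo _ _ mF).
transitivity (\int[lebesgue_measure]_(y in `]x, pi[) (pi - y)%:E)%E.
  by apply: eq_integral => y /set_mem; exact: Df.
rewrite -(integral_itv_bndoo true false mpi); apply: integral_pi_sub.
by rewrite x0.
Qed.

End law_of_cosines.

(** * The kernel in the complex plane *)

Section modulus.
Context {R : realType}.
Implicit Types (z w : R[i]) (r s t x : R).

Lemma cmod_sqrt z : cmod z = Num.sqrt (complex.Re z ^+ 2 + complex.Im z ^+ 2).
Proof. by case: z. Qed.

Lemma cmod_ge0 z : 0 <= cmod z. Proof. by rewrite cmod_sqrt sqrtr_ge0. Qed.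

Lemma cmod_gt0 z : (0 < cmod z) = (z != 0).
Proof.
rewrite lt_neqAle cmod_ge0 andbT eq_sym; congr negb; apply/eqP/eqP => [|->].
  exact: Normc.eq0_normc.
exact: Normc.normc0.
Qed.

Lemma cmodD_le z w : cmod (z - w) <= cmod z + cmod w.
Proof. by have := le_normcD z (- w); rewrite normcN. Qed.

Lemma cmod_real r : 0 <= r -> cmod r%:C = r.
Proof. by move=> r0; rewrite cmod_sqrt/= expr0n/= addr0 sqrtr_sqr ger0_norm. Qed.

Definition polar r t : R[i] := (r * cos t) +i* (r * sin t).

Lemma cmod_polar r t : 0 <= r -> cmod (polar r t) = r.
Proof.
move=> r0; rewrite cmod_sqrt/= !exprMn -mulrDr cos2Dsin2 mulr1 sqrtr_sqr.
exact: ger0_norm.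
Qed.

Lemma polar0 r : polar r 0 = r%:C.
Proof. by rewrite /polar cos0 sin0 mulr1 mulr0. Qed.

Lemma polar_Arg z : z != 0 -> z = polar (cmod z) (Arg z).
Proof.
move=> /ArgP[_ {1}->]; rewrite /polar [LHS]/GRing.mul/= !mul0r subr0 addr0.
by [].
Qed.

Lemma Re_Arg z : z != 0 -> complex.Re z = cmod z * cos (Arg z).
Proof. by move=> /polar_Arg {1}->. Qed.

Lemma Arg_itv z : z != 0 -> - pi < Arg z <= pi.
Proof. by move=> /ArgP[]. Qed.

(** Only the cosine of the angle matters, so [x] may be any representative; later uses choose one in
    a convenient interval. *)
Lemma cmod_sub_polar r t z x : z != 0 -> cos x = cos (t - Arg z) ->
  cmod (polar r t - z) = Num.sqrt (dist2 r (cmod z) x).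
Proof.
move=> z0 cx; rewrite cmod_sqrt; congr Num.sqrt.
rewrite {1 2}(polar_Arg z0) /= /dist2 cx cosB.
have -> : r ^+ 2 = r ^+ 2 * (cos t ^+ 2 + sin t ^+ 2) by rewrite cos2Dsin2 mulr1.
have -> : cmod z ^+ 2 = cmod z ^+ 2 * (cos (Arg z) ^+ 2 + sin (Arg z) ^+ 2).
  by rewrite cos2Dsin2 mulr1.
ring.
Qed.

End modulus.

(** * Measurability on the complex plane *)

Section measurability.
Context {R : realType}.

Lemma continuous_measurable_borelC (f : R[i] -> R) :
  (forall z w, `|f z - f w| <= cmod (z - w)) ->
  measurable_fun [set: borelC R] (f : borelC R -> R).
Proof.
move=> fL; apply: (measurability _ (RGenOpens.measurableE R)).
move=> _ [_ [a [b ->] <-]]; rewrite setTI; apply: sub_sigma_algebra.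
rewrite /= openE => z /= fz.
have /nbhs_ballP[e /= e0 He] : nbhs (f z) `]a, b[%classic.
  by apply: open_nbhs_nbhs; split => //; exact: interval_open.
(* The norm of [R[i]] takes its values in [R[i]], so the radius has to be embedded there. *)
apply/nbhs_ballP; exists e%:C => /=; first by rewrite ltcR.
move=> w; rewrite -ball_normE /= => zw; apply: He.
rewrite -ball_normE /=; apply: le_lt_trans (fL z w) _.
by rewrite -ltcR -cmodE.
Qed.

Lemma measurable_Re : measurable_fun [set: borelC R] (@complex.Re R : borelC R -> R).
Proof.
apply: continuous_measurable_borelC => z w.
rewrite -raddfB cmod_sqrt -sqrtr_sqr ler_wsqrtr// lerDl sqr_ge0//.
Qed.

Lemma measurable_Im : measurable_fun [set: borelC R] (@complex.Im R : borelC R -> R).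
Proof.
apply: continuous_measurable_borelC => z w.
rewrite -raddfB cmod_sqrt -sqrtr_sqr ler_wsqrtr// lerDr sqr_ge0//.
Qed.

Lemma measurable_fun_cmod d (T : measurableType d) (D : set T) (f : T -> R[i]) :
  measurable_fun D (fun p => complex.Re (f p)) -> measurable_fun D (fun p => complex.Im (f p)) ->
  measurable_fun D (fun p => cmod (f p)).
Proof.
move=> mRe mIm; under eq_fun do rewrite cmod_sqrt.
apply: (measurableT_comp (continuous_measurable_fun (@sqrt_continuous R))).
by apply: measurable_funD; exact: measurable_funX.
Qed.

Lemma measurable_cmod : measurable_fun [set: borelC R] (@cmod R : borelC R -> R).
Proof. by apply: measurable_fun_cmod; [exact: measurable_Re|exact: measurable_Im]. Qed.

Lemma measurable_lne_EFin : measurable_fun [set: R] (fun x : R => lne x%:E).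
Proof.
rewrite /lne; apply: measurable_fun_ifT => /=.
    apply: measurable_fun_ler => //; exact: measurable_cst.
  exact: measurable_cst.
by have /measurable_EFinP := @measurable_ln R.
Qed.

Lemma measurable_neq0 : measurable [set z : borelC R | (z : R[i]) != 0].
Proof.
rewrite (_ : [set _ | _] = (@cmod R : borelC R -> R) @^-1` `]0, +oo[).
  by rewrite -[X in measurable X]setTI; exact: measurable_cmod.
by apply/seteqP; split => z /=; rewrite in_itv/= andbT cmod_gt0.
Qed.

(** The cosine decreases on [[0, pi]], so the condition on the argument becomes [Re z >= |z| cos a],
    which involves measurable functions only. *)
Lemma measurable_sector (a : R) : 0 <= a <= pi -> measurable (sector a).
Proof.
move=> a0.
have mg : measurable_fun [set: borelC R] (fun z : borelC R => complex.Re z - cmod z * cos a).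
  apply: measurable_funB; first exact: measurable_Re.
  apply: measurable_funM; last exact: measurable_cst.
  exact: measurable_cmod.
rewrite (_ : sector a = [set z : borelC R | (z : R[i]) != 0] `&`
    (fun z : borelC R => complex.Re z - cmod z * cos a) @^-1` `[0, +oo[).
  apply: measurableI; first exact: measurable_neq0.
  by rewrite -[X in measurable X]setTI; exact: mg.
have cosE (z : R[i]) : z != 0 ->
    (`|Arg z| <= a) = (0 <= complex.Re z - cmod z * cos a).
  move=> z0; have /andP[A1 A2] := Arg_itv z0.
  rewrite Re_Arg// subr_ge0 ler_pM2l ?cmod_gt0// -(cos_norm (Arg z)).
  rewrite [in RHS]leNgt ltr_cos; first by rewrite leNgt.
    by rewrite in_itv.
  by rewrite in_itv/= normr_ge0 ler_norml (ltW A1).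
by apply/seteqP; split => z /= [z0]; rewrite in_itv/= andbT -cosE.
Qed.

End measurability.

(** * The logarithmic defect and its integral along a ray *)

Section log_defect.
Context {R : realType}.
Implicit Types (z w : R[i]) (r s t x : R).

(* The first term depends on the moduli only, hence drops out of a comparison of
   the potential at [z] and at [cmod z]. The value is [+oo] at [w = z], [z != 0]. *)
Definition log_defect z w : \bar R :=
  ((ln (cmod z + cmod w))%:E - lne (cmod (z - w))%:E)%E.

Lemma log_defect_ge0 z w : z != 0 -> (0 <= log_defect z w)%E.
Proof.
move=> z0; have zw0 : 0 < cmod z + cmod w by rewrite ltr_pwDl ?cmod_gt0 ?cmod_ge0.
rewrite /log_defect; have [->|zw] := eqVneq (z - w) 0.
  by rewrite [cmod 0]Normc.normc0 le0_lneNy//= leey.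
by rewrite lne_EFin ?cmod_gt0// -EFinB lee_fin subr_ge0 ler_ln ?posrE ?cmod_gt0// cmodD_le.
Qed.

(** This is why a mass at the origin drops out and only the mass of the punctured plane enters the
    bound. *)
Lemma log_defectz0 z : z != 0 -> log_defect z 0 = 0%E.
Proof.
move=> z0; rewrite /log_defect subr0 {2}/cmod Normc.normc0 addr0.
by rewrite lne_EFin ?cmod_gt0// subee.
Qed.

Lemma polar_neq0 r t : 0 < r -> polar r t != 0.
Proof. by move=> r0; rewrite -cmod_gt0 cmod_polar ?ltW. Qed.

Lemma measurable_log_defect d (T : measurableType d) (D : set T) (f g : T -> R[i]) :
  measurable_fun D (fun p => complex.Re (f p)) ->
  measurable_fun D (fun p => complex.Im (f p)) ->
  measurable_fun D (fun p => complex.Re (g p)) ->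
  measurable_fun D (fun p => complex.Im (g p)) ->
  measurable_fun D (fun p => log_defect (f p) (g p)).
Proof.
move=> mRf mIf mRg mIg; apply: emeasurable_funB.
  apply/measurable_EFinP; apply: (measurableT_comp (@measurable_ln R)).
  by apply: measurable_funD; exact: measurable_fun_cmod.
apply: (measurableT_comp measurable_lne_EFin); apply: measurable_fun_cmod.
  by under eq_fun do rewrite raddfB; exact: measurable_funB.
by under eq_fun do rewrite raddfB; exact: measurable_funB.
Qed.

Lemma measurable_log_defect_polar t D :
  measurable_fun D (fun p : R * borelC R =>
    (p.1^-1%:E * log_defect (polar p.1 t) p.2)%E).
Proof.
apply: measurable_funTS; apply: emeasurable_funM.
  apply/measurable_EFinP; apply: (measurableT_comp measurable_invr).
  exact: measurable_fst.
apply: measurable_log_defect.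
- by apply: measurable_funM; [exact: measurable_fst|exact: measurable_cst].
- by apply: measurable_funM; [exact: measurable_fst|exact: measurable_cst].
- by apply: (measurableT_comp measurable_Re); exact: measurable_snd.
- by apply: (measurableT_comp measurable_Im); exact: measurable_snd.
Qed.

(** The measure [dr/r] is scale invariant, so for [w != 0] the value depends only on the angle
    between the ray and [w]. *)
Definition radial_defect t w : \bar R :=
  (\int[lebesgue_measure]_(r in `]0%R, +oo[) (r^-1%:E * log_defect (polar r t) w))%E.

Lemma radial_defect_ge0 t w : (0 <= radial_defect t w)%E.
Proof.
apply: integral_ge0 => r /=; rewrite in_itv/= andbT => r0.
by rewrite mule_ge0 ?log_defect_ge0 ?polar_neq0// lee_fin invr_ge0 ltW.
Qed.

Lemma radial_defect0 t : radial_defect t 0 = 0%E.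
Proof.
apply: integral0_eq => r /=; rewrite in_itv/= andbT => r0.
by rewrite log_defectz0 ?polar_neq0// mule0.
Qed.

Lemma radial_defectE t w x : w != 0 -> 0 <= x <= pi *+ 2 ->
  cos x = cos (t - Arg w) -> radial_defect t w = ((pi - x) ^+ 2 / 2)%:E.
Proof.
(* Both [cos x] and [(pi - x)^2] are invariant under [x -> 2 pi - x]. *)
wlog x0pi : x / 0 <= x <= pi.
  move=> H w0 /andP[x0 x2] cx; have [xpi|pix] := leP x pi.
    by apply: H => //; rewrite x0.
  rewrite (H (pi *+ 2 - x))//.
  - by congr (_ / _)%:E; rewrite mulr2n; ring.
  - by rewrite subr_ge0 x2 lerBlDr mulr2n lerD2l ltW.
  - by rewrite subr_ge0 x2 lerBlDr lerDl.
  - by rewrite addrC cosD2pi cosN.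
move=> w0 _ cx; have s0 : 0 < cmod w by rewrite cmod_gt0.
have mD : measurable (`]0%R, +oo[ `\ cmod w) by exact: measurableD.
(* Off the single radius [r = cmod w] the distance is nonzero and the defect is the real number
   [log_ratio], whose factor 1/2 comes from the square root. *)
have Df r : (`]0%R, +oo[ `\ cmod w) r ->
    (log_ratio r (cmod w) x / r)%:E = (r^-1%:E * log_defect (polar r t) w)%E.
  rewrite /= in_itv/= andbT => -[r0 /eqP rs].
  rewrite /log_defect cmod_polar ?ltW// (cmod_sub_polar _ w0 cx).
  have d0 := dist2_gt0_neq x r0 s0 rs.
  rewrite lne_EFin ?sqrtr_gt0// -EFinB -EFinM mulrC; congr (_ * (_ - _))%:E.
  rewrite -{1}(sqr_sqrtr (ltW d0)) lnXn ?sqrtr_gt0//.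
  by rewrite -[RHS]mulr1 mulr2n; field.
have mlog := @measurable_log_ratio R (cmod w) x (`]0%R, +oo[ `\ cmod w).
rewrite -(integral_log_ratio s0 x0pi) /radial_defect.
rewrite -[LHS](@integral_setD1 _ _ (cmod w))//; last first.
  by apply: eq_measurable_fun mlog => r /set_mem; exact: Df.
rewrite -[RHS](@integral_setD1 _ _ (cmod w))//.
by apply: eq_integral => r /set_mem/Df.
Qed.

End log_defect.

(** * The sector estimate *)

Section sector_bound.
Context {R : realType}.
Implicit Types (z w : R[i]) (r s t x a : R).

(** The angles from the rays at [t] and [-t] to [w] are represented by [|t - phi|] and [t + phi]
    with [phi = |Arg w|]; the sign of [Arg w] decides which is which. The second may exceed [pi],
    which [radial_defectE] allows. *)
Lemma radial_defect_pm t w : 0 <= t <= pi -> w != 0 ->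
  (radial_defect t w + radial_defect (- t) w =
   ((pi - `|t - `|Arg w| |) ^+ 2 / 2 + (pi - t - `|Arg w|) ^+ 2 / 2)%:E)%E.
Proof.
move=> /andP[t0 tpi] w0; have /andP[A1 A2] := Arg_itv w0.
have Api : `|Arg w| <= pi by rewrite ler_norml A2 ltW.
have A0 : 0 <= `|Arg w| by [].
have tA : `|t - `|Arg w| | <= pi by rewrite ler_norml; apply/andP; split; lra.
rewrite -[X in (_ + X / 2)%:E](_ : (pi - (t + `|Arg w|)) ^+ 2 = _); last first.
  by congr (_ ^+ 2); ring.
have i1 : 0 <= `|t - `|Arg w| | <= pi *+ 2 by rewrite mulr2n; apply/andP; split => //; lra.
have i2 : 0 <= t + `|Arg w| <= pi *+ 2 by rewrite mulr2n; apply/andP; split; lra.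
have [Age0|Alt0] := leP 0 (Arg w).
  rewrite (radial_defectE w0 i1); last by rewrite cos_norm ger0_norm.
  rewrite (radial_defectE w0 i2)// ger0_norm// -[RHS]cosN; congr cos; ring.
rewrite (radial_defectE w0 i2); last by rewrite ltr0_norm//; congr cos; ring.
rewrite (radial_defectE w0 i1); last first.
  by rewrite cos_norm ltr0_norm// -[RHS]cosN; congr cos; ring.
by rewrite addrC.
Qed.

Lemma radial_defect_real w : w != 0 ->
  radial_defect 0 w = ((pi - `|Arg w|) ^+ 2 / 2)%:E.
Proof.
move=> w0; have /andP[A1 A2] := Arg_itv w0.
have Api : `|Arg w| <= pi by rewrite ler_norml A2 ltW.
apply: radial_defectE => //; last by rewrite cos_norm sub0r cosN.
by rewrite normr_ge0 (le_trans Api)// mulr2n lerDl pi_ge0.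
Qed.

(** Pointwise form of the estimate. With [phi = |Arg w|] and [w != 0], the second difference of
    [radial_defect] with step [2 a] at the angle 0 equals [4 a^2 - 2 pi max(2 a - phi, 0)], and the
    maximum is at least [a] on the sector. Terms are moved across so that no extended reals are
    subtracted. *)
Lemma radial_defect_sector a w : 0 <= a <= pi / 2 ->
  (radial_defect (2 * a) w + radial_defect (- (2 * a)) w +
     (2 * pi * a * \1_(sector a) w)%:E <=
   (4 * a ^+ 2 * \1_[set z : borelC R | (z : R[i]) != 0%R] w)%:E +
     (radial_defect 0 w + radial_defect 0 w))%E.
Proof.
move=> /andP[a0 api]; have pi0 := pi_ge0 R.
have [->|w0] := eqVneq w 0.
  rewrite !radial_defect0 !adde0 add0e lee_fin !indicE !memNset ?mulr0//=.
  - by rewrite eqxx.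
  - by rewrite /sector/= eqxx => -[].
rewrite radial_defect_pm//; last by apply/andP; split; lra.
rewrite radial_defect_real// -!EFinD lee_fin.
rewrite [\1_[set _ | _] _]indicE mem_set// mulr1.
have -> : \1_(sector a) w = ((`|Arg w| <= a)%R)%:R :> R.
  rewrite indicE; congr (nat_of_bool _)%:R; apply/idP/idP; rewrite inE /sector/=.
    by case.
  by [].
move: `|Arg w| (normr_ge0 (Arg w)) => x x0.
have [xa|ax] := leP x a.
  rewrite ger0_norm; last lra.
  rewrite -subr_ge0 (_ : _ - _ = 2 * pi * (a - x)); last by rewrite ?mulr1; field.
  by rewrite !mulr_ge0// subr_ge0.
rewrite mulr0 addr0; have [xa2|ax2] := leP x (2 * a).
  rewrite ger0_norm; last lra.
  rewrite -subr_ge0 (_ : _ - _ = 2 * pi * (2 * a - x)); last by rewrite ?mulr1; field.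
  by rewrite !mulr_ge0// subr_ge0.
rewrite ltr0_norm; last lra.
by rewrite -subr_ge0 (_ : _ - _ = 0)//; field.
Qed.

Variable mu : {finite_measure set (borelC R) -> \bar R}.

Let f t (p : R * borelC R) := (p.1^-1%:E * log_defect (polar p.1 t) p.2)%E.

Let D : set (R * borelC R) := `]0%R, +oo[ `*` setT.

Let f0 t p : D p -> (0 <= f t p)%E.
Proof.
case: p => r w [/=]; rewrite in_itv/= andbT => r0 _.
by rewrite mule_ge0 ?log_defect_ge0 ?polar_neq0// lee_fin invr_ge0 ltW.
Qed.

Let mf t : measurable_fun D (f t).
Proof. exact: measurable_log_defect_polar. Qed.

Lemma measurable_radial_defect t :
  measurable_fun [set: borelC R] (radial_defect t : borelC R -> \bar R).
Proof.
exact: (@measurable_fun_integral_on_swap _ _ _ (borelC R) R lebesgue_measure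
  `]0%R, +oo[ setT (f t) _ _ (mf t) (@f0 t)).
Qed.

(** Tonelli's theorem moves the [dr/r] integral outside, where the hypothesis applies at each radius
    separately. *)
Lemma le_integral_radial_defect t :
  (forall r, (0 < r)%R -> \int[mu]_w log_defect (polar r 0) w <=
                      \int[mu]_w log_defect (polar r t) w)%E ->
  (\int[mu]_w radial_defect 0 w <= \int[mu]_w radial_defect t w)%E.
Proof.
move=> H.
have swap u : (\int[mu]_w radial_defect u w =
    \int[lebesgue_measure]_(r in `]0%R, +oo[) \int[mu]_w f u (r, w))%E.
  symmetry; exact: (@fubini_tonelli_on _ _ _ (borelC R) R lebesgue_measure mu
    `]0%R, +oo[ setT (f u) _ _ (mf u) (@f0 u)).
have mfu u : measurable_fun (`]0%R, +oo[ : set R) (fun r => \int[mu]_w f u (r, w))%E.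
  by apply: (@measurable_fun_integral_on _ _ R (borelC R) R mu
    `]0%R, +oo[ setT (f u) _ _ (mf u) (@f0 u)).
rewrite !swap; apply: ge0_le_integral; first by [].
- by move=> r r0; apply: integral_ge0 => w _; exact: f0.
- exact: mfu.
- exact: mfu.
move=> r; rewrite /= in_itv/= andbT => r0; rewrite /f/=.
have mlog u : measurable_fun [set: borelC R] (fun w : borelC R => log_defect (polar r u) w).
  by apply: measurable_log_defect => //; [exact: measurable_Re|exact: measurable_Im].
rewrite !ge0_integralZl//; try by move=> w _; rewrite log_defect_ge0 ?polar_neq0.
- by rewrite lee_pmul2l// ?lte_fin ?invr_gt0// H.
- by rewrite lee_fin invr_ge0 ltW.
- by rewrite lee_fin invr_ge0 ltW.
Qed.

(** The form in which both the condition on the potential and the condition on the polynomial are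
    used. *)
Hypothesis H : forall r t, 0 < r ->
  (\int[mu]_w log_defect (polar r 0) w <= \int[mu]_w log_defect (polar r t) w)%E.

Let cstar : set (borelC R) := [set z : borelC R | (z : R[i]) != 0%R].

(** Integrate [radial_defect_sector] against [mu], bound the integrals at the angles [2 a] and
    [- 2 a] below by the one at 0, cancel the latter and divide by [2 pi a]. *)
Lemma sector_le_pos a : 0 < a <= pi / 2 ->
  (mu (sector a) <= (2 * a / pi)%:E * mu cstar)%E.
Proof.
move=> /andP[a0 api]; have pi0 := pi_gt0 R.
have msec : measurable (sector a) by apply: measurable_sector; apply/andP; split; lra.
have mcstar : measurable cstar by exact: measurable_neq0.
have mI (k : R) (A : set (borelC R)) : measurable A ->
    measurable_fun [set: borelC R] (fun w : borelC R => (k * \1_A w)%:E).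
  move=> mA; apply/measurable_EFinP; apply: measurable_funM.
    exact: measurable_cst.
  exact: measurable_indic.
have iI (k : R) (A : set (borelC R)) : 0 <= k -> measurable A ->
    (\int[mu]_w (k * \1_A w)%:E = k%:E * mu A)%E.
  move=> k0 mA; under eq_integral do rewrite EFinM.
  rewrite ge0_integralZl//; first by rewrite integral_indic// setIT.
  - exact/measurable_EFinP/measurable_indic.
have mr := measurable_radial_defect.
have r0 t (w : borelC R) : [set: borelC R] w -> (0 <= radial_defect t w)%E.
  by move=> _; exact: radial_defect_ge0.
(* The final arithmetic is isolated for arbitrary extended reals [I1], [I2], so that finiteness has
   to be proved for the integral at the angle 0 alone. *)
have cancel_fin (I0 I1 I2 : \bar R) : I0 \is a fin_num ->
    (I0 <= I1 -> I0 <= I2 ->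
     I1 + I2 + (2 * pi * a)%:E * mu (sector a) <=
       (4 * a ^+ 2)%:E * mu cstar + (I0 + I0) ->
     mu (sector a) <= (2 * a / pi)%:E * mu cstar)%E.
  move=> /fineK <- h1 h2.
  rewrite -(fineK (fin_num_measure mu _ msec)) -(fineK (fin_num_measure mu _ mcstar)).
  move: (fine _) (fine _) (fine _) h1 h2 => c s x h1 h2 h3.
  have := le_trans (leeD (leeD h1 h2) (lexx (2 * pi * a * s)%:E)) h3.
  rewrite -!EFinM -!EFinD !lee_fin => h.
  have : a * (2 * pi * s) <= a * (4 * a * c).
    rewrite (_ : a * (2 * pi * s) = 2 * pi * a * s); last by ring.
    rewrite (_ : a * (4 * a * c) = 4 * a ^+ 2 * c); last by ring.
    lra.
  rewrite ler_pM2l// => {}h.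
  by rewrite mulrAC ler_pdivlMr//; lra.
have i0 (k : R) (A : set (borelC R)) (w : borelC R) : 0 <= k ->
    [set: borelC R] w -> (0 <= (k * \1_A w)%:E)%E.
  by move=> k0 _; rewrite lee_fin mulr_ge0.
have k0 : 0 <= 2 * pi * a by rewrite !mulr_ge0// ltW.
have l0 : 0 <= 4 * a ^+ 2 by rewrite mulr_ge0 ?sqr_ge0.
have rr0 t u (w : borelC R) : [set: borelC R] w ->
    (0 <= radial_defect t w + radial_defect u w)%E.
  by move=> _; rewrite adde_ge0 ?radial_defect_ge0.
have mrr t u : measurable_fun [set: borelC R]
    (fun w : borelC R => radial_defect t w + radial_defect u w)%E.
  exact: emeasurable_funD.
have le_int : (\int[mu]_w (radial_defect (2 * a) w + radial_defect (- (2 * a)) w +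
     (2 * pi * a * \1_(sector a) w)%:E) <=
   \int[mu]_w ((4 * a ^+ 2 * \1_cstar w)%:E +
     (radial_defect 0 w + radial_defect 0 w)))%E.
  apply: ge0_le_integral => //.
  - by move=> w _; rewrite adde_ge0 ?rr0 ?i0.
  - by apply: emeasurable_funD => //; exact: mI.
  - by apply: emeasurable_funD => //; exact: mI.
  - by move=> w _; apply: radial_defect_sector; apply/andP; split; lra.
(* The radial defect is at most [pi^2 / 2] and [mu] is finite. *)
have I0y : (\int[mu]_w radial_defect 0 w < +oo)%E.
  apply: (@le_lt_trans _ _ (\int[mu]_w (cst (pi ^+ 2 / 2)%:E) w)%E).
    apply: ge0_le_integral; [by []|exact: r0|exact: mr|exact: measurable_cst|].
    move=> w _ /=; have [->|w0] := eqVneq (w : R[i]) 0.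
      by rewrite radial_defect0 lee_fin divr_ge0 ?sqr_ge0.
    have /andP[A1 A2] := Arg_itv w0.
    have Api : `|Arg w| <= pi by rewrite ler_norml A2 ltW.
    rewrite radial_defect_real// lee_fin ler_pM2r//.
    by move: `|Arg w| Api (normr_ge0 (Arg w)) => y *; nra.
  by rewrite integral_cst// ltey_eq fin_numM ?fin_num_measure.
have I0_fin : (\int[mu]_w radial_defect 0 w)%E \is a fin_num.
  by rewrite ge0_fin_numE//; apply: integral_ge0 => w _; exact: radial_defect_ge0.
move: le_int.
rewrite (ge0_integralD mu measurableT (rr0 _ _) (mrr _ _)
  (fun w => i0 _ (sector a) w k0) (mI _ _ msec)).
rewrite (ge0_integralD mu measurableT (fun w => i0 _ cstar w l0) (mI _ _ mcstar)
  (rr0 _ _) (mrr _ _)).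
rewrite (ge0_integralD mu measurableT
  (r0 (2 * a)) (mr (2 * a)) (r0 (- (2 * a))) (mr (- (2 * a)))).
rewrite (ge0_integralD mu measurableT (r0 0) (mr 0) (r0 0) (mr 0)).
rewrite (iI _ _ k0 msec) (iI _ _ l0 mcstar).
apply: cancel_fin I0_fin _ _.
  exact: (le_integral_radial_defect (fun r => H (2 * a))).
exact: (le_integral_radial_defect (fun r => H (- (2 * a)))).
Qed.

Lemma sector_le a : 0 <= a <= pi / 2 ->
  (mu (sector a) <= (2 * a / pi)%:E * mu cstar)%E.
Proof.
move=> /andP[]; rewrite le_eqVlt => /predU1P[<- _|a0 api]; last first.
  by apply: sector_le_pos; rewrite a0.
have pi0 := pi_gt0 R.
have msec b : 0 <= b <= pi / 2 -> measurable (sector b).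
  by move=> /andP[b0 bpi]; apply: measurable_sector; apply/andP; split; lra.
have mcstar : measurable cstar by exact: measurable_neq0.
have m0 : measurable (sector (0 : R)) by apply: msec; apply/andP; split; lra.
have c0 : 0 <= fine (mu cstar) by exact: fine_ge0.
rewrite mulr0 mul0r mul0e -(fineK (fin_num_measure mu _ m0)) lee_fin.
apply/ler_addgt0Pr => e e0; rewrite add0r.
(* The sector of angle 0 lies in the sector of angle [d]. The minimum keeps [d] in the admissible
   range, the second term makes the bound at [d] at most [e], and the [+ 1] keeps the denominator
   positive when the mass vanishes. *)
pose d := Num.min (pi / 2) (e * pi / (2 * (fine (mu cstar) + 1))).
have d0 : 0 < d.
  by rewrite lt_min !divr_gt0 ?mulr_gt0// ltr_wpDl.
have dpi : d <= pi / 2 by rewrite ge_min lexx.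
have md : measurable (sector d) by apply: msec; rewrite ltW.
have : (mu (sector (0 : R)) <= (2 * d / pi)%:E * mu cstar)%E.
  apply: (le_trans _ (sector_le_pos _)); last by rewrite d0.
  apply: le_measure; rewrite ?inE// => z [z0 /= az]; split => //.
  by rewrite (le_trans az) ?ltW.
move=> h; apply: (@le_trans _ _ (2 * d / pi * fine (mu cstar))).
  by rewrite -lee_fin EFinM !fineK ?fin_num_measure.
have : d <= e * pi / (2 * (fine (mu cstar) + 1)) by rewrite ge_min lexx orbT.
rewrite ler_pdivlMr; last by rewrite mulr_gt0// ltr_wpDl.
move=> {}h; rewrite mulrAC ler_pdivrMr//.
by apply: le_trans h; nra.
Qed.

End sector_bound.

(** * Potentials *)

Section integral_sub_nonneg.
Local Open Scope ereal_scope.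
Context d (T : measurableType d) (R : realType).
Variables (mu : {measure set T -> \bar R}) (D : set T) (mD : measurable D).
Variables (f : T -> R) (g : T -> \bar R).
Hypotheses (intf : mu.-integrable D (EFin \o f)) (mg : measurable_fun D g).
Hypothesis g0 : forall x, D x -> 0 <= g x.

(** The integral of [g] may be [+oo], as happens for the defect at an atom. Then [f - g] has
    integral [-oo]: its positive part is dominated by [f^+], and [g <= f^+ + (f - g)^-] forces the
    negative part to have infinite integral. *)
Lemma integral_sub_nonneg :
  \int[mu]_(x in D) ((f x)%:E - g x) =
  \int[mu]_(x in D) (f x)%:E - \int[mu]_(x in D) g x.
Proof.
have mf := measurable_int mu intf.
have [goo|] := ltP (\int[mu]_(x in D) g x) +oo.
  apply: integralB => //; apply/integrableP; split => //.
  by under eq_integral => x /set_mem/g0/gee0_abs -> do [].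
rewrite leye_eq => /eqP goo.
set h := fun x => (f x)%:E - g x.
have mh : measurable_fun D h by exact: emeasurable_funB.
have hpos x : D x -> h^\+ x <= (EFin \o f)^\+ x.
  move=> Dx; rewrite !funeposE ge_max !le_max lexx orbT andbT /h/=.
  by rewrite geeDl// oppe_le0 g0.
have gle x : D x -> g x <= (EFin \o f)^\+ x + h^\- x.
  move=> Dx; rewrite funeposE funenegE /h/=.
  apply: (@le_trans _ _ ((f x)%:E + - ((f x)%:E - g x))).
    by case: (g x) => [r| |] //=; rewrite lee_fin; lra.
  by apply: leeD; rewrite le_max lexx.
have fposoo : \int[mu]_(x in D) (EFin \o f)^\+ x < +oo.
  exact: integral_funepos_lt_pinfty.
have hposoo : \int[mu]_(x in D) h^\+ x < +oo.
  apply: le_lt_trans fposoo; apply: ge0_le_integral => //.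
  - exact: measurable_funepos.
  - exact: measurable_funepos.
have hneg : \int[mu]_(x in D) h^\- x = +oo.
  apply/eqP; rewrite -leye_eq.
  have : +oo <= \int[mu]_(x in D) (EFin \o f)^\+ x + \int[mu]_(x in D) h^\- x.
    rewrite -ge0_integralD//; last 2 first.
    - exact: measurable_funepos.
    - exact: measurable_funeneg.
    rewrite -goo; apply: ge0_le_integral => //.
    apply: emeasurable_funD; first exact: measurable_funepos.
    exact: measurable_funeneg.
  case: (\int[mu]_(x in D) h^\- x) => //=.
    by move=> r; move: fposoo; case: (\int[mu]_(x in D) _).
  by move: fposoo; case: (\int[mu]_(x in D) _).
have ffin : \int[mu]_(x in D) (f x)%:E \is a fin_num by exact: integrable_fin_num.
rewrite goo integralE hneg -(fineK ffin) /=.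
have : 0 <= \int[mu]_(x in D) h^\+ x by apply: integral_ge0.
by move: hposoo; case: (\int[mu]_(x in D) _).
Qed.

End integral_sub_nonneg.

Section log_potential_defect.
Context {R : realType}.
Variable mu : {finite_measure set (borelC R) -> \bar R}.
Implicit Types z w : R[i].

Let A : set (borelC R) := [set w : borelC R | (cmod w <= 1)%R].
Let B : set (borelC R) := [set w : borelC R | (1 < cmod w)%R].

Let mA : measurable A.
Proof.
rewrite (_ : A = (@cmod R : borelC R -> R) @^-1` `]-oo, 1]).
  by rewrite -[X in measurable X]setTI; exact: measurable_cmod.
by apply/seteqP; split => z /=; rewrite in_itv.
Qed.

Let mB : measurable B.
Proof.
rewrite (_ : B = (@cmod R : borelC R -> R) @^-1` `]1, +oo[).
  by rewrite -[X in measurable X]setTI; exact: measurable_cmod.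
by apply/seteqP; split => z /=; rewrite in_itv/= andbT.
Qed.

Lemma measurable_ln_cmodD (r : R) D :
  measurable_fun D (fun w : borelC R => ln (r + cmod w)).
Proof.
apply: measurable_funTS; apply: (measurableT_comp (@measurable_ln R)).
apply: measurable_funD; first exact: measurable_cst.
exact: measurable_cmod.
Qed.

Let integrable_near (r : R) : 0 < r ->
  mu.-integrable A (EFin \o (fun w : borelC R => ln (r + cmod w))).
Proof.
move=> r0; apply: measurable_bounded_integrable => //.
- by rewrite ltey_eq fin_num_measure.
- exact: measurable_ln_cmodD.
- exists (`|ln r| + `|ln (r + 1)|); split; first exact: num_real.
  move=> M hM w /= w1; apply: le_trans (ltW hM).
  have w0 := cmod_ge0 w.
  have l1 : ln r <= ln (r + cmod w) by rewrite ler_ln ?posrE ?lerDl// ltr_wpDr.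
  have l2 : ln (r + cmod w) <= ln (r + 1).
    by rewrite ler_ln ?posrE ?lerD2l// ltr_wpDr.
  have := ler_norm (ln (r + 1)); have := ler_norm (- ln r); rewrite normrN.
  have := normr_ge0 (ln r); have := normr_ge0 (ln (r + 1)).
  by move=> *; rewrite ler_norml; apply/andP; split; lra.
Qed.

(** For [|w| > 1] the quotient [(r + |w|) / |w|] lies between 1 and [r + 1]; the normalisation
    [1 - z / w] of the far kernel supplies the term [- ln |w|] that makes this bounded. *)
Let integrable_far (r : R) : 0 < r ->
  mu.-integrable B (EFin \o (fun w : borelC R => ln (r + cmod w) - ln (cmod w))).
Proof.
move=> r0; apply: measurable_bounded_integrable => //.
- by rewrite ltey_eq fin_num_measure.
- apply: measurable_funB; first exact: measurable_ln_cmodD.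
  apply: measurable_funTS; apply: (measurableT_comp (@measurable_ln R)).
  exact: measurable_cmod.
- exists (ln (r + 1)); split; first exact: num_real.
  move=> M hM w /= w1; apply: le_trans (ltW hM).
  have w0 : 0 < cmod w by exact: lt_trans w1.
  rewrite -ln_div ?posrE ?addr_gt0//.
  have l0 : 1 <= (r + cmod w) / cmod w by rewrite ler_pdivlMr// mul1r lerDr ltW.
  rewrite ger0_norm ?ln_ge0// ler_ln ?posrE ?addr_gt0 ?(lt_le_trans _ l0)//.
  rewrite ler_pdivrMr// mulrDl mul1r lerD2r ler_peMr ?ltW//.
Qed.

(** For [r > 0], the potential at [r] of the image of [mu] under [w -> -|w|], that is, the case of
    equality in the triangle inequality for every [w]. *)
Definition radial_potential (r : R) : R :=
  fine (\int[mu]_(w in A) (ln (r + cmod w))%:E +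
        \int[mu]_(w in B) (ln (r + cmod w) - ln (cmod w))%:E).

(** In each region the kernel is a bounded radial term minus the nonnegative defect, so the
    integrals split even when the defect has infinite integral; the two defect integrals then
    recombine over the plane. *)
Lemma log_potentialE z : z != 0 ->
  (log_potential mu z =
   (radial_potential (cmod z))%:E - \int[mu]_w log_defect z w)%E.
Proof.
move=> z0; have r0 : 0 < cmod z by rewrite cmod_gt0.
have mld D : measurable_fun D (fun w : borelC R => log_defect z w).
  apply: measurable_funTS.
  by apply: measurable_log_defect => //; [exact: measurable_Re|exact: measurable_Im].
have ld0 D (w : borelC R) : D w -> (0 <= log_defect z w)%E.
  by move=> _; exact: log_defect_ge0.
(* At [w = z] the logarithm is [-oo] and the defect [+oo], so the decompositions below hold there
   too. *)
have lneE (x : R) : 0 <= x -> lne x%:E = if x == 0 then -oo%E else (ln x)%:E.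
  by move=> x0; rewrite /= le_eqVlt ltNge x0 orbF.
have nearE : (\int[mu]_(w in A) lne (cmod (z - (w : R[i])))%:E =
    \int[mu]_(w in A) ((ln (cmod z + cmod w))%:E - log_defect z w))%E.
  apply: eq_integral => w _; rewrite /log_defect lneE ?cmod_ge0//.
  by case: ifPn => // _; rewrite -!EFinB subKr.
have farE : (\int[mu]_(w in B) lne (cmod (1 - z / (w : R[i])))%:E =
    \int[mu]_(w in B) ((ln (cmod z + cmod w) - ln (cmod w))%:E - log_defect z w))%E.
  apply: eq_integral => w /set_mem w1.
  have w0 : 0 < cmod w by exact: lt_trans w1.
  have -> : cmod (1 - z / (w : R[i])) = cmod (z - w) / cmod w.
    rewrite /cmod -Normc.normcV -Normc.normcM mulrBl divff -?cmod_gt0//.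
    by rewrite -[RHS]normcN opprB.
  rewrite /log_defect !lneE ?divr_ge0 ?cmod_ge0//.
  rewrite mulf_eq0 invr_eq0 (gt_eqF w0) orbF.
  have [//|zw] := eqVneq (cmod (z - w)) 0.
  have zw0 : 0 < cmod (z - w) by rewrite lt_neqAle eq_sym zw cmod_ge0.
  by rewrite -!EFinB ln_div ?posrE//; congr EFin; ring.
have If := integrable_fin_num mA (integrable_near r0).
have Ig := integrable_fin_num mB (integrable_far r0).
rewrite /log_potential nearE farE.
rewrite (integral_sub_nonneg mA (integrable_near r0) (mld _) (ld0 _)).
rewrite (integral_sub_nonneg mB (integrable_far r0) (mld _) (ld0 _)).
have -> : (\int[mu]_w log_defect z w =
    \int[mu]_(w in A) log_defect z w + \int[mu]_(w in B) log_defect z w)%E.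
  rewrite -(ge0_integral_setU mu mA mB (mld _) (ld0 _)); last first.
    apply/disj_setPS => w [w1 w2].
    by have : cmod w <= 1 := w1; rewrite leNgt (w2 : 1 < cmod w).
  congr (integral _ _ _); apply/seteqP; split => // w _ /=.
  by case: (leP (cmod w) 1); [left|right].
rewrite /radial_potential fineK; last by rewrite fin_numD If.
have hA : (0 <= \int[mu]_(w in A) log_defect z w)%E.
  by apply: integral_ge0 => w _; exact: log_defect_ge0.
have hB : (0 <= \int[mu]_(w in B) log_defect z w)%E.
  by apply: integral_ge0 => w _; exact: log_defect_ge0.
by rewrite oppeD ?ge0_adde_def ?inE// addeACA.
Qed.

(** The radial term is the same finite number at [z] and at [|z|]; it cancels, and the sign reverses
    the inequality. *)
Lemma le_log_potential_defect z :
  (log_potential mu z <= log_potential mu (cmod z)%:C)%E -> z != 0 ->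
  (\int[mu]_w log_defect (cmod z)%:C w <= \int[mu]_w log_defect z w)%E.
Proof.
move=> + z0; have r0 : 0 < cmod z by rewrite cmod_gt0.
have c0 : (cmod z)%:C != 0 by rewrite -cmod_gt0 cmod_real ?ltW.
rewrite !log_potentialE// (cmod_real (ltW r0)) leeD2lE//.
by rewrite leeN2.
Qed.

End log_potential_defect.

(** * Empirical measures *)


Section empirical.
Context {R : realType}.
Implicit Types z w : R[i].

Variables (f : {poly R[i]}) (s : seq R[i]).
Hypothesis f_neq0 : f != 0.
Hypothesis fE : f = lead_coef f *: \prod_(w <- s) ('X - w%:P).

Let lf : lead_coef f != 0. Proof. by rewrite lead_coef_eq0. Qed.

Lemma mup_prod_lead w : mup w f = count_mem w s.
Proof.
rewrite fE -mul_polyC mupMr ?mu_prod_XsubC//.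
by rewrite /root hornerC.
Qed.

Lemma root_prod_lead w : root f w = (w \in s).
Proof. by rewrite fE rootZ// root_prod_XsubC. Qed.

Lemma cmod_horner z : cmod f.[z] = cmod (lead_coef f) * \prod_(w <- s) cmod (z - w).
Proof.
rewrite {1}fE hornerZ /cmod Normc.normcM; congr (_ * _).
rewrite horner_prod (big_morph _ (@Normc.normcM R) (Normc.normc1 R)).
by apply: eq_bigr => w _; rewrite hornerXsubC.
Qed.

Lemma empirical_measure_seqE (E : set (borelC R)) :
  (empirical_measure f E =
   \sum_(w <- s) (size s)%:R^-1%:E * @dirac _ (borelC R) w R E)%E.
Proof.
have sf : (size f).-1 = size s by rewrite fE size_scale// size_prod_XsubC.
(* The list [s] repeats each root according to its multiplicity, so grouping equal entries yields
   the sum over distinct roots weighted by [mup]. *)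
rewrite /empirical_measure sf -[RHS]big_undup_iterop_count.
have -> : [set w | root f w] = [set` undup s].
  by apply/seteqP; split => w /=; rewrite mem_undup root_prod_lead.
rewrite -fsbig_seq ?undup_uniq//; apply: eq_bigr => w _.
by rewrite mup_prod_lead EFinM -muleA mule_natl.
Qed.

Let c_ge0 : 0 <= (size s)%:R^-1 :> R. Proof. by rewrite invr_ge0. Qed.

(** The empirical measure as a finite sum of scaled point masses, against which an integral is
    evaluated term by term. *)
Let m : {measure set (borelC R) -> \bar R} :=
  msum (fun k => mscale (NngNum c_ge0) (@dirac _ (borelC R) (nth 0 s k) R)) (size s).

Lemma integral_empirical (g : borelC R -> \bar R) :
  measurable_fun setT g -> (forall w, 0 <= g w)%E ->
  (\int[empirical_measure f]_w g w = \sum_(w <- s) (size s)%:R^-1%:E * g w)%E.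
Proof.
move=> mg g0; rewrite (@eq_measure_integral _ _ _ _ m); last first.
  by move=> E _ _; apply: etrans (empirical_measure_seqE E) _; rewrite (big_nth 0) big_mkord.
rewrite ge0_integral_measure_sum// (big_nth 0) big_mkord.
apply: eq_bigr => i _; rewrite ge0_integral_mscale//.
by rewrite integral_dirac// diracT mul1e.
Qed.

Lemma empirical_measure_fin : fin_num_fun (empirical_measure f : set (borelC R) -> \bar R).
Proof.
move=> E _; rewrite empirical_measure_seqE; apply/sum_fin_numP => w _ _.
by rewrite fin_numM// diracE.
Qed.

Lemma sum_log_defect z : z \notin s ->
  (\sum_(w <- s) log_defect z w =
   (\sum_(w <- s) ln (cmod z + cmod w) - ln (\prod_(w <- s) cmod (z - w)))%:E)%E.
Proof.
elim: s => [|w t IH]; first by rewrite !big_nil ln1 subr0.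
rewrite inE negb_or => /andP[zw zt]; rewrite !big_cons IH//.
have zw0 : 0 < cmod (z - w) by rewrite cmod_gt0 subr_eq0.
have p0 : 0 < \prod_(w <- t) cmod (z - w).
  rewrite big_seq; apply: prodr_gt0 => v vt; rewrite cmod_gt0 subr_eq0.
  by apply: contraNneq zt => ->.
rewrite /log_defect lne_EFin// -!EFinD lnM ?posrE//; congr EFin; ring.
Qed.

(** For polynomials the inequality comes directly from the factorisation: the sum of defects is a
    radial term minus the logarithm of [|f(z)|] divided by the modulus of the leading
    coefficient. *)
Lemma le_empirical_defect z : z != 0 -> cmod f.[z] <= cmod f.[(cmod z)%:C] ->
  (\int[empirical_measure f]_w log_defect (cmod z)%:C w <=
   \int[empirical_measure f]_w log_defect z w)%E.
Proof.
move=> z0 fz; have r0 : 0 < cmod z by rewrite cmod_gt0.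
have c0 : (cmod z)%:C != 0 by rewrite -cmod_gt0 cmod_real ?ltW.
have mld u : measurable_fun [set: borelC R] (fun w : borelC R => log_defect u w).
  by apply: measurable_log_defect => //; [exact: measurable_Re|exact: measurable_Im].
rewrite !integral_empirical//; try by move=> w; exact: log_defect_ge0.
rewrite -!ge0_sume_distrr//; try by move=> w _; exact: log_defect_ge0.
apply: lee_wpmul2l; first by rewrite lee_fin.
(* At a root of [f] the right-hand side is [+oo]. *)
have [zs|zs] := boolP (z \in s).
  have ldz : log_defect z z = +oo%E.
    by rewrite /log_defect subrr [cmod 0]Normc.normc0 le0_lneNy.
  rewrite [leRHS](_ : _ = +oo%E) ?leey// (big_rem z zs)/= ldz.
  rewrite addye// gt_eqF// (@lt_le_trans _ _ 0%E)// big_seq sume_ge0//.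
  by move=> w _; exact: log_defect_ge0.
have fz0 : cmod f.[z] != 0.
  by rewrite gt_eqF// cmod_gt0 -[_ == _]/(root f z) root_prod_lead.
(* Since [|f(|z|)| >= |f(z)| > 0], the point [|z|] is not a root either, and both sums of defects
   are real. *)
have cs : (cmod z)%:C \notin s.
  rewrite -root_prod_lead; apply: contra fz0 => /eqP f0.
  move: fz; rewrite f0 [cmod 0]Normc.normc0 => fz.
  by rewrite eq_le fz cmod_ge0.
rewrite !sum_log_defect// cmod_real ?(ltW r0)// lee_fin lerD2l lerN2.
have p0 u : u \notin s -> 0 < \prod_(w <- s) cmod (u - w).
  move=> us; rewrite big_seq; apply: prodr_gt0 => v vs; rewrite cmod_gt0 subr_eq0.
  by apply: contraNneq us => ->.
rewrite ler_ln ?posrE ?p0//.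
by move: fz; rewrite !cmod_horner ler_pM2l// cmod_gt0.
Qed.
End empirical.

(** * Bundled finite measures and the assembly of the two statements *)

Lemma finite_measure_of d (T : measurableType d) (R : realType)
    (mu : {measure set T -> \bar R}) :
  fin_num_fun mu ->
  exists nu : {finite_measure set T -> \bar R},
    (nu : {measure set T -> \bar R}) = mu.
Proof.
move=> mufin.
have sf : sigma_finite setT mu by apply: fin_num_fun_sigma_finite mufin; rewrite measure0.
pose H1 := isFinite.Build _ _ _ _ mufin.
pose H2 := isSFinite.Build _ _ _ _ (sfinite_measure_sigma_finite sf).
pose H3 := isSigmaFinite.Build _ _ _ _ sf.
(* The underlying set function stays the same; only the finiteness structures required by the sector
   estimate are added. *)
pose nu := HB.pack_for (FiniteMeasure.type T R) (Measure.sort mu) H1 H2 H3.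
by exists nu; exact: eq_measure.
Qed.

Theorem mainTheorem2 (R : realType) :
  (forall mu : {measure set (borelC R) -> \bar R},
     (mu setT <= 1)%E ->
     conj_symmetric mu ->
     (forall z : R[i],
        (log_potential mu z <= log_potential mu (cmod z)%:C)%E) ->
     forall alpha : R, 0 <= alpha <= pi / 2 ->
       (mu (sector alpha) <=
        (2 * alpha / pi)%:E * mu [set z : borelC R | (z : R[i]) != 0%R])%E)
  /\
  (forall f : {poly R[i]}, (1 < size f)%N ->
     (forall z : R[i], `|f.[z]| <= f.[`|z|]) ->
     forall alpha : R, 0 <= alpha <= pi / 2 ->
       (empirical_measure f (sector alpha) <=
        (2 * alpha / pi)%:E *
        empirical_measure f [set z : borelC R | (z : R[i]) != 0%R])%E).
Proof.
split.
  move=> mu mu1 _ u_le alpha alpha_itv.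
  have mu_fin : fin_num_fun mu.
    by apply: lty_fin_num_fun; exact: le_lt_trans mu1 (ltry _).
  have [nu nuE] := finite_measure_of mu_fin.
  rewrite -nuE in u_le *; apply: sector_le alpha_itv => r t r0.
  have r_ge0 := ltW r0.
  (* Writing [r] as the modulus of [r e^(it)] turns the point [r] of the positive axis into the
     [|z|] of the hypothesis. *)
  rewrite polar0 -[in X in (X <= _)%E](cmod_polar t r_ge0).
  by apply: le_log_potential_defect (polar_neq0 _ r0); exact: u_le.
move=> f sf f_le alpha alpha_itv.
have f0 : f != 0 by rewrite -size_poly_gt0 (ltn_trans _ sf).
have [s fE] := closed_field_poly_normal f.
have [nu nuE] := @finite_measure_of _ _ R (empirical_measure f) (empirical_measure_fin f0 fE).
have nuEE E : nu E = empirical_measure f E.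
  exact: (congr1 (fun m : {measure set (borelC R) -> \bar R} => m E) nuE).
rewrite -!nuEE; apply: sector_le alpha_itv => r t r0.
have r_ge0 := ltW r0.
rewrite polar0 -[in X in (X <= _)%E](cmod_polar t r_ge0).
have fz : cmod f.[polar r t] <= cmod f.[(cmod (polar r t))%:C].
  have := f_le (polar r t); rewrite (cmodE (polar r t)) => fle.
  rewrite -lecR -!cmodE; apply: (le_trans fle).
  (* In the partial order of [R[i]], being above a modulus makes [f(|z|)] real and nonnegative,
     hence equal to its own modulus. *)
  by rewrite ger0_norm// (le_trans _ fle).
have intE g : (\int[nu]_w g w = \int[empirical_measure f]_w g w)%E.
  by apply: eq_measure_integral => E _ _; exact: nuEE.
by rewrite !intE; exact: (le_empirical_defect f0 fE (polar_neq0 t r0) fz).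
Qed.
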